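(* Let $E\in\mathcal{C}(J,\{c_k\},\{n_k\},\{a_k\})$ be a Cantor-like set and let $0<\theta<1$. Then $$\dim_L^\theta E=\liminf_{k\to+\infty}\frac{\log (n_{k+1}\cdots n_{l(\theta,k)})}{(1-\frac1\theta)\log\delta_k},$$ where $\delta_k=\prod_{i=1}^k c_i$ and $l(\theta,k)=\max\{l\in\mathbb{Z}^+:\delta_l\ge(\delta_k)^{1/\theta}\}$ for $k\ge1$.
   Context: Cantor-like sets: let $\{a_k\}_{k\ge1}\subset\mathbb{R}^+$ with $\sum_k a_k<+\infty$; $\{n_k\}\subset\mathbb{Z}^+$ with $n_k\ge2$; $\{c_k\}\subset\mathbb{R}^+$ with $0<c_k<1$ and $\inf_k c_k>0$. Words: $\Omega_0=\{\emptyset\}$, $\Omega_k=\{\sigma_1\cdots\sigma_k:1\le\sigma_j\le n_j\}$, $\Omega=\bigcup_k\Omega_k$, with concatenation $\sigma*j$. Let $J\subset\mathbb{R}^n$ be a closed set of finite diameter with nonempty interior, $J_\emptyset=J$. Sets $J_\sigma$, $\sigma\in\Omega$, are such that for every $k\ge1$ and $\sigma\in\Omega_{k-1}$, $J_{\sigma*1},\dots,J_{\sigma*n_k}\subset J_\sigma$ are each geometrically similar to $J_\sigma$, have pairwise disjoint interiors, and satisfy $c_k(1-a_k)\le |J_{\sigma*j}|/|J_\sigma|\le c_k(1+a_k)$ ($|\cdot|$ = diameter). Then $E=\bigcap_{k\ge1}\bigcup_{\sigma\in\Omega_k}J_\sigma$ is a Cantor-like set, and $\mathcal{C}(J,\{c_k\},\{n_k\},\{a_k\})$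 denotes the class of all such sets. For $F\subset\mathbb{R}^n$, $N_r(A)$ is the smallest number of balls of radius $r$ covering $A$, and the lower spectrum is $\dim_L^\theta F=\sup\{s\ge0:\exists\, b,c>0\ \forall\,0<R<b,\ \forall x\in F,\ N_{R^{1/\theta}}(B(x,R)\cap F)\ge c(R/R^{1/\theta})^s\}$. *)

(* Defs.v *)
From HB Require Import structures.
From mathcomp Require Import all_boot all_order all_algebra.
From mathcomp Require Import all_classical all_reals all_analysis.
Set Implicit Arguments. Unset Strict Implicit. Unset Printing Implicit Defensive.
Import Order.TTheory GRing.Theory Num.Theory.
Local Open Scope classical_set_scope.
Local Open Scope ring_scope.

Section CantorDefs.
Variables (R : realType) (n : nat).

Definition ept := 'rV[R]_n.

Definition euclid_dist (x y : ept) : R :=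
  Num.sqrt (\sum_(i < n) (x ord0 i - y ord0 i) ^+ 2).

Definition eball (x : ept) (r : R) : set ept := [set y | euclid_dist x y <= r].

Definition eoball (x : ept) (r : R) : set ept := [set y | euclid_dist x y < r].

Definition einterior (A : set ept) : set ept :=
  [set x | exists2 r : R, 0 < r & eoball x r `<=` A].

Definition eclosed (A : set ept) : Prop :=
  forall x, ~ A x -> exists2 r : R, 0 < r & eoball x r `<=` ~` A.

Definition ebounded (A : set ept) : Prop :=
  exists M : R, forall x y, A x -> A y -> euclid_dist x y <= M.

Definition diam (A : set ept) : R :=
  sup [set d | exists x y, [/\ A x, A y & d = euclid_dist x y]].

Definition geom_similar (A B : set ept) : Prop :=
  exists (f : ept -> ept) (r : R), 0 < r /\
    (forall x y, euclid_dist (f x) (f y) = r * euclid_dist x y) /\ f @` A = B.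

Definition word (ns : nat -> nat) (k : nat) (s : seq nat) : Prop :=
  size s = k /\ forall j, (j < k)%N -> (1 <= nth 0%N s j <= ns j.+1)%N.

(* the class C(J, {c_k}, {n_k}, {a_k}) (sequences indexed from 1) *)
Definition in_cantor_class (J : set ept) (c : nat -> R) (ns : nat -> nat)
    (a : nat -> R) (E : set ept) : Prop :=
  exists Jw : seq nat -> set ept,
    [/\ Jw [::] = J,
     (forall k s, (1 <= k)%N -> word ns k.-1 s ->
        forall j, (1 <= j <= ns k)%N ->
          [/\ Jw (rcons s j) `<=` Jw s,
              geom_similar (Jw s) (Jw (rcons s j)) &
              c k * (1 - a k) <= diam (Jw (rcons s j)) / diam (Jw s)
                <= c k * (1 + a k)]),
     (forall k s, (1 <= k)%N -> word ns k.-1 s ->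
        forall j j', (1 <= j <= ns k)%N -> (1 <= j' <= ns k)%N -> j != j' ->
          einterior (Jw (rcons s j)) `&` einterior (Jw (rcons s j')) = set0) &
     E = \bigcap_(k in [set k | (1 <= k)%N])
           \bigcup_(s in [set s | word ns k s]) Jw s].

Definition covnum (r : R) (A : set ept) : \bar R :=
  ereal_inf [set ((size s)%:R)%:E | s in
    [set s : seq ept | A `<=` \bigcup_(x in [set` s]) eball x r]].

Definition lower_spectrum (theta : R) (F : set ept) : \bar R :=
  ereal_sup [set s%:E | s in [set s : R | 0 <= s /\
    exists b cc : R, [/\ 0 < b, 0 < cc &
      forall RR : R, 0 < RR -> RR < b -> forall x, F x ->
        ((cc * (RR / RR `^ theta^-1) `^ s)%:E
           <= covnum (RR `^ theta^-1) (eball x RR `&` F))%E]]].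

End CantorDefs.

Definition delta (R : realType) (c : nat -> R) (k : nat) : R :=
  \prod_(1 <= i < k.+1) c i.

Definition lidx (R : realType) (c : nat -> R) (theta : R) (k : nat) : nat :=
  xget 0%N [set l : nat | [/\ (1 <= l)%N,
     delta c k `^ theta^-1 <= delta c l &
     forall m, (1 <= m)%N -> delta c k `^ theta^-1 <= delta c m -> (m <= l)%N]].

(* Main.v *)
Require Import Defs.
From HB Require Import structures.
From mathcomp Require Import all_boot all_order all_algebra.
From mathcomp Require Import all_classical all_reals all_analysis.
From mathcomp Require Import ring lra.
Set Implicit Arguments. Unset Strict Implicit. Unset Printing Implicit Defensive.
Import Order.TTheory GRing.Theory Num.Theory.
Local Open Scope classical_set_scope.
Local Open Scope ring_scope.

(* Every piece J_s of level k is a similar copy of J, and the summability of a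
   makes its diameter comparable to delta_k. Since similarities of R^n are
   onto, J_s contains a ball of radius comparable to delta_k, so the centres of
   distinct pieces of level k are separated by a multiple of delta_k, and a
   packing argument bounds the number of pieces of level k near any given ball
   of radius comparable to delta_k. As n_k >= 2, the same argument forces
   delta_(k+m) <= eta * delta_k for some m depending only on eta (nothing else
   keeps c_k away from 1); in particular E meets every piece.

   For R comparable to delta_k, the trace of E on B(x, R) thus lies in boundedly
   many pieces of level k and contains the trace on one of them (up to a
   constant factor on R). Pieces of level l(theta, k) have diameter comparable
   to R^(1/theta), so the covering number is n_(k+1) ... n_(l(theta, k)) up to
   bounded factors, which disappear in the lower limit. *)

(** * Euclidean geometry *)

Section Euclid.
Variables (R : realType) (n : nat).
Local Notation V := (ept R n).
Local Notation d := (@euclid_dist R n).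
Implicit Types (x y z : V) (A : set V).

(** With [a], [b], [c] the three sums, the squares [(b * u i - c * v i) ^+ 2] add up to
    [b * (a * b - c ^+ 2)]; if [b = 0], every [v i] vanishes. *)
Lemma cauchy_schwarz_sum (u v : 'I_n -> R) :
  (\sum_i u i * v i) ^+ 2 <= (\sum_i u i ^+ 2) * (\sum_i v i ^+ 2).
Proof.
have expand (b c : R) : \sum_i (b * u i - c * v i) ^+ 2 =
    b ^+ 2 * (\sum_i u i ^+ 2) - (2 * b * c) * (\sum_i u i * v i)
    + c ^+ 2 * \sum_i v i ^+ 2.
  rewrite !mulr_sumr -sumrB -big_split /=.
  by apply: eq_bigr => i _; ring.
set a := \sum_i u i ^+ 2; set b := \sum_i v i ^+ 2; set c := \sum_i u i * v i.
have b0 : 0 <= b by apply: sumr_ge0 => i _; rewrite sqr_ge0.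
have : 0 <= \sum_i (b * u i - c * v i) ^+ 2.
  by apply: sumr_ge0 => i _; rewrite sqr_ge0.
have -> : \sum_i (b * u i - c * v i) ^+ 2 = b * (a * b - c ^+ 2).
  by rewrite expand -/a -/b -/c; ring.
have [b_eq0 _|b_neq0] := eqVneq b 0; last first.
  by rewrite pmulr_rge0 ?lt_def ?b_neq0// subr_ge0.
suff -> : c = 0 by rewrite expr0n/= b_eq0 mulr0.
rewrite /c big1// => i _; move/eqP: b_eq0.
rewrite psumr_eq0; last by move=> j _; rewrite sqr_ge0.
by move=> /allP/(_ i (mem_index_enum _)); rewrite sqrf_eq0 => /eqP ->; rewrite mulr0.
Qed.

Lemma eudist_ge0 x y : 0 <= d x y. Proof. exact: sqrtr_ge0. Qed.

Lemma eudist_sqr x y : d x y ^+ 2 = \sum_i (x ord0 i - y ord0 i) ^+ 2.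
Proof. by rewrite sqr_sqrtr//; apply: sumr_ge0 => i _; rewrite sqr_ge0. Qed.

Lemma eudistxx x : d x x = 0.
Proof. by rewrite /euclid_dist big1 ?sqrtr0// => i _; rewrite subrr expr0n. Qed.

Lemma eudist_coord x y i : `|x ord0 i - y ord0 i| <= d x y.
Proof.
rewrite -sqrtr_sqr ler_wsqrtr// (bigD1 i)//= lerDl.
by apply: sumr_ge0 => j _; rewrite sqr_ge0.
Qed.

Lemma eudist_le_sum x y : d x y <= \sum_i `|x ord0 i - y ord0 i|.
Proof.
set S := \sum_i _; have S0 : 0 <= S by apply: sumr_ge0.
rewrite -[leRHS](ger0_norm S0) -sqrtr_sqr ler_wsqrtr// expr2 mulr_suml.
apply: ler_sum => i _; rewrite -[leLHS]ger0_norm ?sqr_ge0// normrX expr2.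
by rewrite ler_wpM2l// /S (bigD1 i)//= lerDl sumr_ge0.
Qed.

Lemma eudist_triangle y x z : d x z <= d x y + d y z.
Proof.
rewrite -ler_sqr ?nnegrE ?addr_ge0 ?eudist_ge0// eudist_sqr sqrrD !eudist_sqr.
pose u i := x ord0 i - y ord0 i; pose v i := y ord0 i - z ord0 i.
have -> : \sum_i (x ord0 i - z ord0 i) ^+ 2 =
    \sum_i u i ^+ 2 + (\sum_i u i * v i) *+ 2 + \sum_i v i ^+ 2.
  by rewrite -sumrMnl -!big_split/=; apply: eq_bigr => i _; rewrite /u /v; ring.
rewrite lerD2r lerD2l lerMn2r /=.
apply: (le_trans (ler_norm _)); rewrite -ler_sqr ?nnegrE ?mulr_ge0 ?eudist_ge0//.
by rewrite real_normK ?num_real// exprMn !eudist_sqr cauchy_schwarz_sum.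
Qed.

Definition similarity (f : V -> V) (r : R) :=
  0 < r /\ forall x y, d (f x) (f y) = r * d x y.

(* Polarization shows that [f - f 0] preserves inner products up to [r ^+ 2],
   so the images of the standard basis form an invertible matrix. *)
Lemma similarity_surjective f r : similarity f r -> forall y, exists x, f x = y.
Proof.
move=> [r0 df]; pose g x : 'rV[R]_n := f x - f 0.
have sqd x y : \sum_i (f x ord0 i - f y ord0 i) ^+ 2 =
    r ^+ 2 * \sum_i (x ord0 i - y ord0 i) ^+ 2.
  by rewrite -!eudist_sqr df exprMn.
have dotg x y : \sum_i g x ord0 i * g y ord0 i =
    r ^+ 2 * \sum_i x ord0 i * y ord0 i.
  have polar (u v : 'I_n -> R) : \sum_i u i * v i =
      2^-1 * (\sum_i u i ^+ 2 + \sum_i v i ^+ 2 - \sum_i (u i - v i) ^+ 2).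
    by rewrite -big_split -sumrB mulr_sumr /=; apply: eq_bigr => i _; field.
  have gsq z : \sum_i g z ord0 i ^+ 2 = r ^+ 2 * \sum_i z ord0 i ^+ 2.
    rewrite (_ : \sum_i z ord0 i ^+ 2 =
      \sum_i (z ord0 i - (0 : V) ord0 i) ^+ 2); last first.
      by apply: eq_bigr => i _; rewrite mxE subr0.
    by rewrite -sqd; apply: eq_bigr => i _; rewrite !mxE.
  have gB : \sum_i (g x ord0 i - g y ord0 i) ^+ 2 =
      r ^+ 2 * \sum_i (x ord0 i - y ord0 i) ^+ 2.
    by rewrite -sqd; apply: eq_bigr => i _; rewrite !mxE; ring.
  rewrite (polar (g x ord0) (g y ord0)) (polar (x ord0) (y ord0)) gB !gsq.
  by ring.
have r2 : r ^+ 2 != 0 by rewrite expf_neq0// gt_eqF.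
pose M : 'M[R]_n := \matrix_i g (delta_mx ord0 i).
have gM x : g x *m M^T = r ^+ 2 *: x.
  apply/rowP => i; rewrite !mxE.
  transitivity (\sum_j g x ord0 j * g (delta_mx ord0 i) ord0 j).
    by apply: eq_bigr => j _; rewrite !mxE.
  rewrite dotg (bigD1 i)//= big1 ?addr0; first by rewrite mxE !eqxx mulr1.
  by move=> j ji; rewrite mxE (negbTE ji) andbF mulr0.
have MM : M *m (r ^- 2 *: M^T) = 1%:M.
  apply/row_matrixP => i.
  by rewrite row_mul -scalemxAr rowK gM scalerA mulVf// scale1r row1.
have MTM := mulmx1C MM.
have gE x : g x = x *m M.
  rewrite -[LHS]mulmx1 -MTM -scalemxAl -scalemxAr mulmxA gM -scalemxAl scalerA.
  by rewrite mulVf// scale1r.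
move=> y; exists ((y - f 0) *m (r ^- 2 *: M^T)).
apply: (@addIr _ (- f 0)).
by rewrite -[LHS]/(g _) gE -mulmxA MTM mulmx1.
Qed.

Lemma similarity_comp f r g s :
  similarity f r -> similarity g s -> similarity (f \o g) (r * s).
Proof.
move=> [r0 df] [s0 dg]; split; first exact: mulr_gt0.
by move=> x y /=; rewrite df dg mulrA.
Qed.

(** By definition a similarity only scales distances; its surjectivity supplies a preimage for each
    point of the image ball. *)
Lemma similarity_eoball f r x s A : similarity f r ->
  eoball x s `<=` A -> eoball (f x) (r * s) `<=` f @` A.
Proof.
move=> fr xA y; have [w <-] := similarity_surjective fr y.
rewrite /eoball/= (fr.2) ltr_pM2l ?fr.1// => xw.
by exists w => //; apply: xA.
Qed.

Lemma similarity_eclosed f r A : similarity f r -> eclosed A -> eclosed (f @` A).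
Proof.
move=> fr cA y; have [w <-] := similarity_surjective fr y => fAw.
have [|s s0 ws] := cA w; first by move=> Aw; apply: fAw; exists w.
exists (r * s); first by rewrite mulr_gt0// fr.1.
move=> v vs [u Au uv]; apply: (ws u) => //; move: vs.
by rewrite /eoball/= -uv (fr.2) ltr_pM2l ?fr.1.
Qed.

Lemma eudist_le_diam A x y : ebounded A -> A x -> A y -> d x y <= diam A.
Proof.
move=> [M AM] Ax Ay; apply: ub_le_sup; last by exists x, y.
by exists M => _ [u [v [Au Av ->]]]; exact: AM.
Qed.

Lemma diam_le A M : A !=set0 ->
  (forall x y, A x -> A y -> d x y <= M) -> diam A <= M.
Proof.
move=> [x Ax] AM; apply: ge_sup; first by exists (d x x), x, x.
by move=> _ [u [v [Au Av ->]]]; exact: AM.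
Qed.

Lemma similarity_ebounded f r A :
  similarity f r -> ebounded A -> ebounded (f @` A).
Proof.
move=> [r0 df] [M AM]; exists (r * M) => _ _ [u Au <-] [v Av <-].
by rewrite df ler_pM2l// AM.
Qed.

Lemma similarity_diam f r A : similarity f r -> A !=set0 -> ebounded A ->
  diam (f @` A) = r * diam A.
Proof.
move=> fr A0 bA; have [r0 df] := fr; apply/eqP; rewrite eq_le; apply/andP; split.
  apply: diam_le; first by case: A0 => x Ax; exists (f x), x.
  move=> _ _ [u Au <-] [v Av <-]; rewrite df ler_pM2l//.
  exact: eudist_le_diam.
rewrite -ler_pdivlMl//; apply: diam_le => // x y Ax Ay.
rewrite ler_pdivlMl// -df; apply: eudist_le_diam; last 2 first.
  - by exists x.
  - by exists y.
exact: similarity_ebounded fr bA.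
Qed.

(** A ball contains two points at distance [r / 2] along a coordinate axis, which exists because
    [0 < n]. *)
Lemma diam_gt0 A : (0 < n)%N -> ebounded A -> (exists x, einterior A x) ->
  0 < diam A.
Proof.
move=> n0 bA [x [r r0 xA]].
pose y : V := \row_j (x ord0 j + r / 2 * (j == Ordinal n0)%:R).
have xy : d x y = r / 2.
  rewrite /euclid_dist (bigD1 (Ordinal n0))//= big1 ?addr0.
    rewrite mxE eqxx mulr1 opprD addNKr sqrrN sqrtr_sqr ger0_norm//.
    by rewrite divr_ge0// ltW.
  by move=> j /negbTE jn; rewrite mxE jn mulr0 addr0 subrr expr0n.
have Ax : A x by apply: xA; rewrite /eoball/= eudistxx.
have Ay : A y by apply: xA; rewrite /eoball/= xy; lra.
apply: lt_le_trans (eudist_le_diam bA Ax Ay); rewrite xy; lra.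
Qed.

End Euclid.

(** * Packing and counting words *)

Section Packing.
Variables (R : realType) (n : nat).
Local Notation d := (@euclid_dist R n).

(* Distinct [e]-separated points lie in distinct cells of a grid of mesh
   [e / n.+1], and a ball of radius [t * e] meets boundedly many cells. *)
Lemma packing_bound (t : R) : exists K : nat,
  forall (I : eqType) (s : seq I) (f : I -> ept R n) (x : ept R n) (e : R),
    0 < e -> uniq s ->
    {in s &, forall i j, i != j -> e <= d (f i) (f j)} ->
    {in s, forall i, d x (f i) <= t * e} -> (size s <= K)%N.
Proof.
(* In each coordinate the ball has width [2 * t * e], that is, [2 * t * n.+1] cells of side [h]. *)
pose N := Num.truncn (2 * t * n.+1%:R).
exists #|{ffun 'I_n -> 'I_N.+1}| => I s f x e e0 us sep near.
pose h := e / n.+1%:R; have h0 : 0 < h by rewrite divr_gt0.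
pose v i k := (f i ord0 k - x ord0 k + t * e) / h.
have v_itv i k : i \in s -> 0 <= v i k <= 2 * t * n.+1%:R.
  move=> si; have := le_trans (eudist_coord x (f i) k) (near _ si).
  rewrite ler_norml => /andP[lo hi]; apply/andP; split.
    by rewrite divr_ge0 ?(ltW h0)//; lra.
  rewrite ler_pdivrMr// /h mulrCA mulfK ?pnatr_eq0//; lra.
pose g i : {ffun 'I_n -> 'I_N.+1} := [ffun k => inord (Num.truncn (v i k))].
have trunc_lt i k : i \in s -> (Num.truncn (v i k) < N.+1)%N.
  by move=> si; rewrite ltnS le_truncn//; have /andP[] := v_itv i k si.
(* Points of one cell differ by at most [h] in each coordinate, so their distance is at most
   [n * h]; the mesh uses [n.+1] to make this strictly less than [e]. *)
have g_inj : {in s &, injective g}.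
  move=> i j si sj gij; apply/eqP/negPn/negP => ij.
  have := sep _ _ si sj ij; apply/negP; rewrite -ltNge.
  apply: le_lt_trans (eudist_le_sum _ _) _.
  apply: (@le_lt_trans _ _ (\sum_(k < n) h)); last first.
    rewrite sumr_const card_ord /h -[_ *+ _]mulr_natr mulrAC.
    by rewrite ltr_pdivrMr// ltr_pM2l// ltr_nat.
  apply: ler_sum => k _.
  have : Num.truncn (v i k) = Num.truncn (v j k).
    move/ffunP: gij => /(_ k); rewrite !ffunE => /(congr1 val) /=.
    by rewrite !inordK ?trunc_lt.
  have /andP[vi0 _] := v_itv i k si; have /andP[vj0 _] := v_itv j k sj.
  have := truncn_itv vi0; have := truncn_itv vj0 => + + vij; rewrite vij.
  set T := Num.truncn _; rewrite -addn1 natrD => /andP[aj bj] /andP[ai bi].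
  have -> : f i ord0 k - f j ord0 k = (v i k - v j k) * h.
    by rewrite /v -mulrBl divfK ?gt_eqF//; ring.
  rewrite normrM (gtr0_norm h0) ger_pMl//.
  by rewrite ler_norml; apply/andP; split; lra.
have ug : uniq (map g s) by rewrite map_inj_in_uniq.
by rewrite -(size_map g) -(card_uniqP ug) max_card.
Qed.

End Packing.

(** Induction on [s]: at most [K] members of [U] are related to its first element, and the rest of
    [s] covers the others. Below, [U] indexes pieces and [s] lists ball centres. *)
Lemma leq_size_cover (I T : eqType) (P : I -> T -> Prop) (K : nat)
    (U : seq I) (s : seq T) :
  uniq U -> (forall i, i \in U -> exists2 x, x \in s & P i x) ->
  (forall x (W : seq I), uniq W -> {subset W <= U} ->
     (forall i, i \in W -> P i x) -> (size W <= K)%N) ->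
  (size U <= K * size s)%N.
Proof.
elim: s U => [|x s IH] U uU cov bnd /=.
  by rewrite muln0 leqn0; case: U cov {uU bnd} => // i U /(_ i (mem_head _ _)) [].
rewrite mulnS -(count_predC (fun i => `[< P i x >])) -!size_filter leq_add//.
  apply: (bnd x); first exact: filter_uniq.
    by move=> i; rewrite mem_filter => /andP[].
  by move=> i; rewrite mem_filter => /andP[/asboolP].
apply: IH; first exact: filter_uniq.
  move=> i; rewrite mem_filter /= => /andP[/asboolP nPi /cov[y + Pi]].
  by rewrite inE => /orP[/eqP yx|sy]; [case: nPi; rewrite -yx | exists y].
by move=> y W uW sW PW; apply: (bnd y) => // i /sW; rewrite mem_filter => /andP[].
Qed.

Section Words.
Variable ns : nat -> nat.

(** The continuations of length [m] of a word of level [k], as a list without repetition so that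
    [size] counts pieces. *)
Fixpoint extensions (k m : nat) : seq (seq nat) :=
  if m is m'.+1
  then [seq rcons u j | u <- extensions k m', j <- iota 1 (ns (k + m'.+1))]
  else [:: [::]].

Lemma size_extensions k m :
  size (extensions k m) = (\prod_(k.+1 <= i < (k + m).+1) ns i)%N.
Proof.
elim: m => [|m IH]; first by rewrite addn0 big_geq.
by rewrite /= size_allpairs size_iota IH addnS [RHS]big_nat_recr//= ltnS leq_addr.
Qed.

Lemma extensions_uniq k m : uniq (extensions k m).
Proof.
elim: m => //= m IH; rewrite allpairs_uniq ?iota_uniq//.
by move=> [u i] [v j] _ _ /= /eqP; rewrite eqseq_rcons => /andP[/eqP -> /eqP ->].
Qed.

Lemma extensionsSP k m v : reflect
  (exists u j, [/\ u \in extensions k m, (1 <= j <= ns (k + m.+1))%N & v = rcons u j])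
  (v \in extensions k m.+1).
Proof.
apply: (iffP allpairsP) => [[[u j] /= [? + ->]]|[u [j [? jn ->]]]].
  by rewrite mem_iota add1n ltnS => ?; exists u, j.
by exists (u, j); split; rewrite //= mem_iota add1n ltnS.
Qed.

Lemma word_rconsP k s j :
  word ns k.+1 (rcons s j) <-> word ns k s /\ (1 <= j <= ns k.+1)%N.
Proof.
split=> [[]|[[sk ws] jn]].
  rewrite size_rcons => -[sk] ws; split; last first.
    by have := ws k (ltnSn k); rewrite nth_rcons sk ltnn eqxx.
  by split=> // i ik; have := ws i (ltnW ik); rewrite nth_rcons sk ik.
split; first by rewrite size_rcons sk.
move=> i; rewrite ltnS leq_eqVlt => /orP[/eqP ->|ik].
  by rewrite nth_rcons sk ltnn eqxx.
by rewrite nth_rcons sk ik ws.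
Qed.

Lemma word_nil : word ns 0 [::]. Proof. by split. Qed.

Lemma word0 s : word ns 0 s -> s = [::]. Proof. by case=> /size0nil. Qed.

Lemma word_cat k m s u :
  word ns k s -> u \in extensions k m -> word ns (k + m) (s ++ u).
Proof.
move=> ws; elim: m u => [|m IH] u.
  by rewrite inE => /eqP ->; rewrite addn0 cats0.
by move=> /extensionsSP[v [j [/IH wv jn ->]]]; rewrite -rcons_cat addnS;
  apply/word_rconsP; rewrite -addnS.
Qed.

Lemma word_split k m s : word ns (k + m) s ->
  exists t u, [/\ s = t ++ u, word ns k t & u \in extensions k m].
Proof.
elim: m s => [|m IH] s; first by rewrite addn0; exists s, [::]; rewrite cats0.
rewrite addnS; case/lastP: s => [[]//|s j] /word_rconsP[/IH[t [u [-> wt eu]]] jn].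
exists t, (rcons u j); rewrite -rcons_cat; split=> //.
by apply/extensionsSP; exists u, j; rewrite addnS.
Qed.

Lemma word_extensions0 k s : word ns k s <-> s \in extensions 0 k.
Proof.
split=> [|/(word_cat word_nil)//].
by rewrite -[k]add0n => /word_split[t [u [-> /word0 -> ]]].
Qed.

End Words.

(** * Geometry of the pieces *)

(** Cantor's intersection theorem. In each coordinate every [z m - eps m] lies below every
    [z m' + eps m'], so the suprema of the lower bounds are the coordinates of a common point. *)
Lemma nested_eclosed_point (R : realType) (n : nat) (F : nat -> set (ept R n))
    (eps : nat -> R) :
  (forall m m', (m <= m')%N -> F m' `<=` F m) ->
  (forall m, F m !=set0) -> (forall m, eclosed (F m)) ->
  (forall m x y, F m x -> F m y -> euclid_dist x y <= eps m) ->
  (forall r, 0 < r -> exists m, eps m <= r) ->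
  exists y, forall m, F m y.
Proof.
move=> Fsub F0 Fcl Feps eps0.
have [z Fz] := choice F0.
have Fzm m m' : (m <= m')%N -> F m (z m') by move=> /Fsub; apply; exact: Fz.
have eps_ge0 m : 0 <= eps m by rewrite -(eudistxx (z m)) Feps.
have zi m m' i : z m ord0 i - eps m <= z m' ord0 i + eps m'.
  have [mm'|/ltnW mm'] := leqP m m'.
    have := le_trans (eudist_coord (z m) (z m') i) (Feps _ _ _ (Fz m) (Fzm _ _ mm')).
    by rewrite ler_norml => /andP[]; have := eps_ge0 m'; lra.
  have := le_trans (eudist_coord (z m) (z m') i) (Feps _ _ _ (Fzm _ _ mm') (Fz m')).
  by rewrite ler_norml => /andP[]; have := eps_ge0 m; lra.
pose S i := [set z m ord0 i - eps m | m in @setT nat].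
pose y : ept R n := \row_i sup (S i).
have yz m i : `|y ord0 i - z m ord0 i| <= eps m.
  have lo : z m ord0 i - eps m <= y ord0 i.
    rewrite mxE; apply: ub_le_sup; last by exists m.
    by exists (z 0 ord0 i + eps 0) => _ [m' _ <-]; exact: zi.
  have hi : y ord0 i <= z m ord0 i + eps m.
    rewrite mxE; apply: ge_sup; first by exists (z 0 ord0 i - eps 0), 0%N.
    by move=> _ [m' _ <-]; exact: zi.
  by rewrite ler_norml; apply/andP; split; lra.
exists y => m; apply: contrapT => /Fcl[r r0 yr].
(* [y] is within [n * eps m0] of [z m0], which is within [eps m0] of [z (maxn m m0)]; dividing by
   [n.+2] keeps the total strictly below [r]. *)
have [m0 m0r] := eps0 (r / n.+2%:R) (divr_gt0 r0 (ltr0Sn _ _)).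
have : eoball y r (z (maxn m m0)); last first.
  by move=> /yr; apply; apply: Fzm; exact: leq_maxl.
rewrite /eoball/=; apply: le_lt_trans (eudist_triangle (z m0) _ _) _.
have dyz : euclid_dist y (z m0) <= eps m0 * n%:R.
  apply: le_trans (eudist_le_sum _ _) _.
  apply: le_trans (ler_sum _ (fun i _ => yz m0 i)) _.
  by rewrite sumr_const card_ord mulr_natr.
have dzz := Feps _ _ _ (Fz m0) (Fzm _ _ (leq_maxr m m0)).
apply: le_lt_trans (lerD dyz dzz) _.
move: m0r; rewrite ler_pdivlMr// -addn2 natrD mulrDr.
by have := eps_ge0 m0; rewrite le_eqVlt => /orP[/eqP <-|]; lra.
Qed.

Lemma seq_positive_lower_bound (R : realType) (T : eqType) (s : seq T) (f : T -> R) :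
  {in s, forall x, 0 < f x} -> exists2 m, 0 < m & {in s, forall x, m <= f x}.
Proof.
elim: s => [|x s IH] f0; first by exists 1.
have [y ys|m m0 ms] := IH; first by apply: f0; rewrite inE ys orbT.
exists (Num.min m (f x)); first by rewrite lt_min m0 f0 ?mem_head.
move=> y; rewrite inE => /orP[/eqP ->|/ms my]; first by rewrite ge_min lexx orbT.
by rewrite ge_min my.
Qed.

(** * Products of the contraction ratios *)

Section Delta.
Variables (R : realType) (c : nat -> R).
Hypothesis c_itv : forall k, (1 <= k)%N -> 0 < c k < 1.

Lemma delta0 : delta c 0 = 1. Proof. by rewrite /delta big_geq. Qed.

Lemma deltaS k : delta c k.+1 = delta c k * c k.+1.
Proof. by rewrite /delta big_nat_recr. Qed.

Lemma delta_gt0 k : 0 < delta c k.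
Proof.
elim: k => [|k IH]; first by rewrite delta0.
by rewrite deltaS mulr_gt0//; have /andP[] := c_itv (ltn0Sn k).
Qed.

Lemma delta_ltS k : delta c k.+1 < delta c k.
Proof.
rewrite deltaS gtr_pMr ?delta_gt0//.
by have /andP[] := c_itv (ltn0Sn k).
Qed.

Lemma delta_le k m : (k <= m)%N -> delta c m <= delta c k.
Proof.
move=> /subnK <-; elim: (m - k)%N => // i IH.
by rewrite addSn (le_trans (ltW (delta_ltS _))).
Qed.

Lemma delta_le1 k : delta c k <= 1. Proof. by rewrite -delta0 delta_le. Qed.

Lemma delta_lt1 k : (0 < k)%N -> delta c k < 1.
Proof.
by move=> k0; apply: le_lt_trans (delta_le k0) _; rewrite -delta0 delta_ltS.
Qed.

Lemma delta_ratio_ge cmin k m : 0 < cmin ->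
  (forall k, (1 <= k)%N -> cmin <= c k) ->
  cmin ^+ m * delta c k <= delta c (k + m).
Proof.
move=> cmin0 cge; elim: m => [|m IH]; first by rewrite expr0 mul1r addn0.
rewrite addnS deltaS exprSr mulrAC ler_pM//; last exact: cge.
- by rewrite mulr_ge0 ?exprn_ge0 ?ltW ?delta_gt0.
- exact: ltW.
Qed.

End Delta.

(** * Similarity, diameters and separation of the pieces *)

Section Scheme.
Variables (R : realType) (n : nat) (J : set (ept R n)).
Variables (c : nat -> R) (ns : nat -> nat) (a : nat -> R).
Variable Jw : seq nat -> set (ept R n).
Hypothesis n_gt0 : (0 < n)%N.
Hypothesis a_gt0 : forall k, (1 <= k)%N -> 0 < a k.
Hypothesis a_cvg : cvg ((fun N => \sum_(1 <= k < N) a k) @ \oo).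
Hypothesis c_itv : forall k, (1 <= k)%N -> 0 < c k < 1.
Hypothesis J_closed : eclosed J.
Hypothesis J_bounded : ebounded J.
Hypothesis J_interior : exists x, einterior J x.
Hypothesis Jw_nil : Jw [::] = J.
Hypothesis Jw_step : forall k s, (1 <= k)%N -> word ns k.-1 s ->
  forall j, (1 <= j <= ns k)%N ->
  [/\ Jw (rcons s j) `<=` Jw s,
      geom_similar (Jw s) (Jw (rcons s j)) &
      c k * (1 - a k) <= diam (Jw (rcons s j)) / diam (Jw s) <= c k * (1 + a k)].
Hypothesis Jw_disjoint : forall k s, (1 <= k)%N -> word ns k.-1 s ->
  forall j j', (1 <= j <= ns k)%N -> (1 <= j' <= ns k)%N -> j != j' ->
  einterior (Jw (rcons s j)) `&` einterior (Jw (rcons s j')) = set0.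

Lemma piece_similar k s : word ns k s ->
  exists f r, similarity f r /\ Jw s = f @` J.
Proof.
elim: k s => [|k IH] s; first by move=> /word0 ->; exists id, 1; split;
  [by split => // x y; rewrite mul1r | rewrite image_id].
case/lastP: s => [[]//|s j] /word_rconsP[ws jn].
have [f [r [fr Jf]]] := IH _ ws.
have [_ [g [t [t0 [dg Jg]]]] _] := @Jw_step k.+1 s isT ws j jn.
exists (g \o f), (t * r); split; first exact: similarity_comp.
by rewrite -Jg Jf image_comp.
Qed.

Lemma piece_sub k m s u : word ns k s -> u \in extensions ns k m ->
  Jw (s ++ u) `<=` Jw s.
Proof.
move=> ws; elim: m u => [|m IH] u; first by rewrite inE => /eqP ->; rewrite cats0.
move=> /extensionsSP[v [j [ev jn ->]]]; rewrite -rcons_cat.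
apply: subset_trans (IH _ ev).
have wv := word_cat ws ev; rewrite addnS in jn.
by have [] := @Jw_step (k + m).+1 (s ++ v) isT wv j jn.
Qed.

Lemma piece_closed k s : word ns k s -> eclosed (Jw s).
Proof.
by move=> /piece_similar[f [r [fr ->]]]; exact: similarity_eclosed fr J_closed.
Qed.

Lemma piece_bounded k s : word ns k s -> ebounded (Jw s).
Proof.
by move=> /piece_similar[f [r [fr ->]]]; exact: similarity_ebounded fr J_bounded.
Qed.

Lemma J_nonempty : J !=set0.
Proof.
case: J_interior => x [r r0 xJ]; exists x; apply: xJ.
by rewrite /eoball/= eudistxx.
Qed.

Lemma piece_diam_gt0 k s : word ns k s -> 0 < diam (Jw s).
Proof.
move=> /piece_similar[f [r [fr ->]]].
by rewrite (similarity_diam fr J_nonempty J_bounded) mulr_gt0 ?fr.1// diam_gt0.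
Qed.

(** The ratio of the radius of an inner ball to the diameter is invariant under similarities, so the
    ratio found in [J] serves for all pieces. *)
Lemma piece_inner_ball : exists2 e, 0 < e & forall k s, word ns k s ->
  exists x, eoball x (e * diam (Jw s)) `<=` Jw s.
Proof.
have dJ := diam_gt0 n_gt0 J_bounded J_interior.
case: J_interior => x [r r0 xJ]; exists (r / diam J); first exact: divr_gt0.
move=> k s /piece_similar[f [t [ft ->]]]; exists (f x).
rewrite (similarity_diam ft J_nonempty J_bounded).
by rewrite mulrCA divfK ?gt_eqF//; exact: similarity_eoball.
Qed.

Lemma sum_a_le_lim N : \sum_(1 <= k < N) a k <= limn (fun N => \sum_(1 <= k < N) a k).
Proof.
apply: (@nondecreasing_cvgn_le _ (fun N => \sum_(1 <= k < N) a k)) => //.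
apply/nondecreasing_seqP => -[|m]; first by rewrite !big_geq.
by rewrite [leRHS]big_nat_recr//= lerDl ltW// a_gt0.
Qed.

(** The product of the factors [1 + a i] is at most the exponential of the sum of the [a i], hence
    at most [expR L]. *)
Lemma piece_diam_upper : exists2 A, 0 < A &
  forall k s, word ns k s -> diam (Jw s) <= A * delta c k.
Proof.
set L := limn (fun N => \sum_(1 <= k < N) a k).
have dJ := diam_gt0 n_gt0 J_bounded J_interior.
exists (diam J * expR L); first by rewrite mulr_gt0// expR_gt0.
suff main k s : word ns k s ->
    diam (Jw s) <= diam J * expR (\sum_(1 <= i < k.+1) a i) * delta c k.
  move=> k s /main /le_trans; apply.
  rewrite ler_wpM2r ?(ltW (delta_gt0 c_itv _))// ler_wpM2l ?(ltW dJ)//.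
  by rewrite ler_expR sum_a_le_lim.
elim: k s => [|k IH] s.
  by move=> /word0 ->; rewrite big_geq// expR0 delta0 !mulr1 Jw_nil.
case/lastP: s => [[]//|s j] /word_rconsP[ws jn].
have [_ _ /andP[_]] := @Jw_step k.+1 s isT ws j jn.
rewrite ler_pdivrMr ?(piece_diam_gt0 ws)// => /le_trans; apply.
have /andP[c0 _] := c_itv (ltn0Sn k).
have a0 := a_gt0 (ltn0Sn k).
rewrite big_nat_recr//= expRD deltaS.
have := IH _ ws; set S := expR (\sum_(_ <= _ < _) _) => IHs.
rewrite [leRHS](_ : _ = c k.+1 * expR (a k.+1) * (diam J * S * delta c k));
  last by ring.
apply: ler_pM => //; first by rewrite mulr_ge0 ?(ltW c0)//; lra.
  exact: ltW (piece_diam_gt0 ws).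
by rewrite ler_wpM2l ?(ltW c0)// expR_ge1Dx.
Qed.

(* Where [a k >= 1] the lower ratio bound is vacuous; the finitely many levels
   concerned are handled by taking a minimum over their finitely many words. *)
Lemma piece_diam_lower : exists2 A, 0 < A &
  forall k s, word ns k s -> A * delta c k <= diam (Jw s).
Proof.
set L := limn (fun N => \sum_(1 <= k < N) a k).
have [k0 k0P] : exists k0, L - 2^-1 <= \sum_(1 <= i < k0.+1) a i.
  have [N _ NP] := (cvgrPdist_le _ L).1 a_cvg 2^-1 (ltac:(by [])).
  exists N; have := NP N.+1 (leqnSn N); rewrite /= ler_norml => /andP[]; lra.
have tail k : (k0 <= k)%N -> \sum_(k0.+1 <= i < k.+1) a i <= 2^-1.
  move=> kk; have := sum_a_le_lim k.+1.
  rewrite (@big_cat_nat _ _ _ k0.+1)//= -/L; lra.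
pose W := flatten [seq extensions ns 0 k | k <- iota 0 k0.+1].
have WP k s : (k <= k0)%N -> word ns k s -> s \in W.
  move=> kk /word_extensions0 sk; apply/flatten_mapP; exists k => //.
  by rewrite mem_iota.
have [m m0 mW] : exists2 m, 0 < m & {in W, forall s, m <= diam (Jw s)}.
  apply: seq_positive_lower_bound => s /flatten_mapP[k _ /word_extensions0 ws].
  exact: piece_diam_gt0 ws.
exists (m / 2); first by lra.
have low k s : (k <= k0)%N -> word ns k s -> m * delta c k <= diam (Jw s).
  move=> kk ws; apply: le_trans (mW s (WP _ _ kk ws)).
  by rewrite ger_pMr// delta_le1.
move=> k s ws; have d0 := delta_gt0 c_itv k.
have [kk|/ltnW kk] := leqP k k0.
  apply: le_trans (low _ _ kk ws); rewrite ler_pM2r//; lra.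
(* Beyond level [k0] the product of the [1 - a j] is at least one minus the sum of the [a j], hence
   at least [2^-1]; this is the factor lost in [m / 2]. *)
suff main i t : word ns (k0 + i) t ->
    m * (1 - \sum_(k0.+1 <= j < (k0 + i).+1) a j) * delta c (k0 + i) <= diam (Jw t).
  rewrite -(subnKC kk) in ws d0 *; apply: le_trans (main _ _ ws).
  rewrite ler_pM2r// ler_pM2l//; have := tail (k0 + (k - k0))%N (leq_addr _ _).
  by lra.
elim: i t {s k ws d0 kk} => [|i IH] t.
  by rewrite addn0 big_geq// subr0 mulr1; exact: low.
rewrite addnS; case/lastP: t => [[]//|t j] /word_rconsP[wt jn].
have [_ _ /andP[+ _]] := @Jw_step (k0 + i).+1 t isT wt j jn.
rewrite ler_pdivlMr ?(piece_diam_gt0 wt)//; apply: le_trans.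
have /andP[c0 _] := c_itv (ltn0Sn (k0 + i)).
have a0 := a_gt0 (ltn0Sn (k0 + i)).
have := tail (k0 + i).+1 (leqW (leq_addr _ _)).
have := IH _ wt; rewrite [in X in _ -> X -> _]big_nat_recr ?ltnS ?leq_addr//=.
rewrite [in X in _ -> _ -> X]big_nat_recr ?ltnS ?leq_addr//= deltaS.
set S := \sum_(_ <= _ < _) _ => IHt Sa.
have S0 : 0 <= S.
  rewrite /S big_nat; apply: sumr_ge0 => l /andP[kl _].
  by rewrite ltW// a_gt0// (leq_ltn_trans _ kl).
have d0 := delta_gt0 c_itv (k0 + i).
have a1 : 0 <= 1 - a (k0 + i).+1 by lra.
apply: le_trans (ler_wpM2l (mulr_ge0 (ltW c0) a1) IHt).
rewrite [leRHS](_ : _ = (m * ((1 - a (k0 + i).+1) * (1 - S))) *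
  (delta c (k0 + i) * c (k0 + i).+1)); last by ring.
rewrite ler_pM2r ?mulr_gt0// ler_pM2l//.
have := mulr_ge0 (ltW a0) S0; lra.
Qed.

Lemma einterior_mono (A B : set (ept R n)) : A `<=` B -> einterior A `<=` einterior B.
Proof. by move=> AB x [r r0 xA]; exists r => //; exact: subset_trans AB. Qed.

Lemma piece_disjoint k s t : word ns k s -> word ns k t -> s != t ->
  einterior (Jw s) `&` einterior (Jw t) = set0.
Proof.
elim: k s t => [|k IH] s t; first by move=> /word0 -> /word0 ->; rewrite eqxx.
case/lastP: s => [[]//|s i]; case/lastP: t => [_ []//|t j].
move=> /word_rconsP[ws ins] /word_rconsP[wt jn]; rewrite eqseq_rcons negb_and.
have [<- /= ij|st _] := eqVneq s t; first exact: (@Jw_disjoint k.+1).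
have [si _ _] := @Jw_step k.+1 s isT ws i ins.
have [tj _ _] := @Jw_step k.+1 t isT wt j jn.
rewrite -subset0 => x [/(einterior_mono si) xs /(einterior_mono tj) xt].
by rewrite -(IH _ _ ws wt st).
Qed.

(** All that the counting below uses of diameters and interiors. Each [z s] is the centre of a ball
    inside its piece; if [z t] were closer than the radius of that ball, it would be interior to two
    pieces with disjoint interiors. *)
Lemma scheme_regular : exists (A e : R) (z : seq nat -> ept R n),
  [/\ 0 < A, 0 < e,
   forall k s x y, word ns k s -> Jw s x -> Jw s y ->
     euclid_dist x y <= A * delta c k,
   forall k s, word ns k s -> Jw s (z s) &
   forall k s t, word ns k s -> word ns k t -> s != t ->
     e * delta c k <= euclid_dist (z s) (z t)].
Proof.
have [A A0 AP] := piece_diam_upper; have [B B0 BP] := piece_diam_lower.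
have [e e0 eP] := piece_inner_ball.
(* [choice] needs a value at every list, so lists that are not words get the junk centre [0]. *)
have centre s : exists x, word ns (size s) s ->
    eoball x (e * diam (Jw s)) `<=` Jw s.
  have [/eP[x xs]|nw] := pselect (word ns (size s) s); first by exists x.
  by exists 0.
have [z zP] := choice centre.
have zw k s : word ns k s -> eoball (z s) (e * diam (Jw s)) `<=` Jw s.
  by move=> ws; have [sk _] := ws; rewrite -sk in ws; exact: zP.
have z0 k s : word ns k s -> 0 < e * diam (Jw s).
  by move=> ws; rewrite mulr_gt0 ?(piece_diam_gt0 ws).
exists A, (e * B), z; split => //; first exact: mulr_gt0.
- move=> k s x y ws sx sy; apply: le_trans (AP _ _ ws).
  by apply: eudist_le_diam => //; exact: piece_bounded ws.
- by move=> k s ws; apply: (zw _ _ ws); rewrite /eoball/= eudistxx (z0 _ _ ws).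
move=> k s t ws wt st; rewrite leNgt; apply/negP => zst.
have : (einterior (Jw s) `&` einterior (Jw t)) (z t); last first.
  by rewrite (piece_disjoint ws wt st).
have es : e * B * delta c k <= e * diam (Jw s).
  by rewrite -mulrA ler_pM2l// (BP _ _ ws).
split; last by exists (e * diam (Jw t)); [exact: z0 wt | exact: zw wt].
exists (e * diam (Jw s) - euclid_dist (z s) (z t)); first by lra.
move=> y; rewrite /eoball/= => ty; apply: (zw _ _ ws).
apply: le_lt_trans (eudist_triangle (z t) _ _) _; lra.
Qed.

End Scheme.

(** * Covering numbers of the limit set *)

(** For [1 <= p] and [0 <= t] the exponent on the right is nonnegative, so monotonicity of powers
    applies to it. *)
Lemma powR_div_powR (R : realType) (x p t : R) : 0 < x ->
  (x / x `^ p) `^ t = (x `^ ((p - 1) * t))^-1.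
Proof.
move=> x0; rewrite -{1}(powRr1 (ltW x0)) -powRB; last first.
  by apply/implyP => _; rewrite gt_eqF.
by rewrite -powRrM -powRN -mulNr opprB.
Qed.

Section RegularScheme.
Variables (R : realType) (n : nat) (c : nat -> R) (ns : nat -> nat).
Variables (Jw : seq nat -> set (ept R n)) (z : seq nat -> ept R n) (A e cmin : R).
Local Notation d := (@euclid_dist R n).
Local Notation delta := (delta c).
Local Notation N k l := (\prod_(k.+1 <= i < l.+1) ns i)%N.
Hypothesis ns_ge2 : forall k, (1 <= k)%N -> (2 <= ns k)%N.
Hypothesis c_itv : forall k, (1 <= k)%N -> 0 < c k < 1.
Hypothesis cmin_gt0 : 0 < cmin.
Hypothesis c_ge : forall k, (1 <= k)%N -> cmin <= c k.
Hypothesis A_gt0 : 0 < A.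
Hypothesis e_gt0 : 0 < e.
Hypothesis piece_dist : forall k s x y, word ns k s -> Jw s x -> Jw s y ->
  d x y <= A * delta k.
Hypothesis piece_centre : forall k s, word ns k s -> Jw s (z s).
Hypothesis centre_sep : forall k s t, word ns k s -> word ns k t -> s != t ->
  e * delta k <= d (z s) (z t).
Hypothesis sub_piece : forall k m s u, word ns k s -> u \in extensions ns k m ->
  Jw (s ++ u) `<=` Jw s.
Hypothesis closed_piece : forall k s, word ns k s -> eclosed (Jw s).

Let E := \bigcap_(k in [set k | (1 <= k)%N])
           \bigcup_(s in [set s | word ns k s]) Jw s.

Let delta_pos k : 0 < delta k := delta_gt0 c_itv k.

Lemma level_packing t : exists K : nat, forall k x (U : seq (seq nat)),
  uniq U -> {in U, forall s, word ns k s} ->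
  {in U, forall s, d x (z s) <= t * delta k} -> (size U <= K)%N.
Proof.
have [K KP] := packing_bound n (t / e); exists K => k x U uU wU xU.
apply: (KP _ U z x (e * delta k)) => //; first exact: mulr_gt0.
  by move=> s s' sU s'U; apply: centre_sep; exact: wU.
by move=> s /xU; rewrite mulrA divfK ?gt_eqF.
Qed.

Lemma prod_ns_gt0 k l : (0 < N k l)%N.
Proof.
rewrite big_nat; apply: prodn_cond_gt0 => i /andP[ki _].
by apply: leq_trans (ns_ge2 (leq_trans _ ki)).
Qed.

Lemma prod_ns_ge_exp k m : (2 ^ m <= N k (k + m))%N.
Proof.
elim: m => [|m IH]; first by rewrite addn0 big_geq.
by rewrite addnS big_nat_recr/= ?ltnS ?leq_addr// expnSr leq_mul// ns_ge2.
Qed.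

Lemma prod_ns_cat k l m : (k <= l)%N -> (l <= m)%N -> N k m = (N k l * N l m)%N.
Proof. by move=> kl lm; rewrite (@big_cat_nat _ _ _ l.+1). Qed.

Lemma word_nseq1 k : word ns k (nseq k 1%N).
Proof.
split=> [|j jk]; first by rewrite size_nseq.
by rewrite nth_nseq jk /= ltnW// ns_ge2.
Qed.

(** The centres of the descendants lie in a single piece, hence within [A / eta * delta (k + m)] of
    its centre, and packing at level [k + m] applies. The word of ones is a sample word of level
    [k]. *)
Lemma descendants_bound (eta : R) : 0 < eta -> exists K : nat, forall k m,
  eta * delta k <= delta (k + m) -> (N k (k + m) <= K)%N.
Proof.
move=> eta0; have [K KP] := level_packing (A / eta); exists K => k m km.
have ws := word_nseq1 k; set s := nseq k 1%N in ws.
rewrite -size_extensions -(size_map (cat s)).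
apply: (KP (k + m)%N (z s)).
- by rewrite map_inj_uniq ?extensions_uniq// => u v /eqP; rewrite eqseq_cat// => /andP[_ /eqP].
- by move=> _ /mapP[u eu ->]; exact: word_cat.
move=> _ /mapP[u eu ->].
have wsu := word_cat ws eu.
apply: le_trans (piece_dist ws (piece_centre ws) (sub_piece ws eu (piece_centre wsu))) _.
by rewrite -mulrA ler_pM2l// ler_pdivlMl.
Qed.

(** After [K] generations there are at least [2 ^ K > K] descendants, so the opposite inequality
    would contradict [descendants_bound]. *)
Lemma delta_decay (eta : R) : 0 < eta ->
  exists m, forall k, delta (k + m) <= eta * delta k.
Proof.
move=> eta0; have [K KP] := descendants_bound eta0.
exists K => k; rewrite leNgt; apply/negP => /ltW /KP.
by apply/negP; rewrite -ltnNge; exact: leq_trans (ltn_expl K _) (prod_ns_ge_exp k K).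
Qed.

Lemma delta_small (eta : R) : 0 < eta -> exists m, delta m <= eta.
Proof.
by move=> /delta_decay[m /(_ 0%N)]; rewrite add0n delta0 mulr1 => ?; exists m.
Qed.

(** Appending the letter [1] repeatedly to [s] gives nested closed pieces with diameters tending to
    zero; their common point lies in [E]. *)
Lemma limit_set_meets_piece k s : word ns k s -> exists2 x, E x & Jw s x.
Proof.
move=> ws; pose tail m := nseq m 1%N.
have tailE j m : tail m \in extensions ns j m.
  elim: m => [|m IH]; first by rewrite inE.
  apply/extensionsSP; exists (tail m), 1%N; split=> //.
    by rewrite /= ltnW// ns_ge2// addnS.
  by rewrite /tail -[m.+1]addn1 nseqD cats1.
have tailD m i : tail (m + i)%N = tail m ++ tail i by rewrite /tail nseqD.
have wt m := word_cat ws (tailE k m).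
have [|||||y yF] := @nested_eclosed_point R n (fun m => Jw (s ++ tail m))
    (fun m => A * delta (k + m)).
- move=> m m' /subnKC <-; rewrite tailD catA.
  exact: sub_piece (wt m) (tailE _ _).
- by move=> m; exists (z (s ++ tail m)); exact: piece_centre (wt m).
- by move=> m; exact: closed_piece (wt m).
- by move=> m x y; exact: piece_dist (wt m).
- move=> r r0; have [m mr] := delta_small (divr_gt0 r0 A_gt0).
  exists m; rewrite mulrC -ler_pdivlMr//; apply: le_trans mr.
  by apply: (delta_le c_itv); exact: leq_addl.
have sy : Jw s y by have := yF 0%N; rewrite cats0.
(* Membership in [E] asks for a piece at every level: a prefix of [s] up to level [k], an extension
   of [s] beyond it. *)
exists y => // j /= j1; have [jk|/ltnW kj] := leqP j k.
  move: ws sy; rewrite -(subnKC jk) => /word_split[t [u [-> wt' eu]]] ty.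
  by exists t => //; exact: (sub_piece wt' eu).
by exists (s ++ tail (j - k)%N) => //=; rewrite -[X in word _ X _](subnKC kj).
Qed.

(** Every descendant of [s] contains a point of [E], and a ball of the cover reaches only boundedly
    many of them, since their centres lie within [r + A * delta (k + m)] of its own. *)
Lemma cover_size_lower t : exists K : nat, forall k m s (r : R) (C : seq (ept R n)),
  r <= t * delta (k + m) -> word ns k s ->
  Jw s `&` E `<=` \bigcup_(y in [set` C]) eball y r -> (N k (k + m) <= K * size C)%N.
Proof.
have [K KP] := level_packing (t + A); exists K => k m s r C rt ws cov.
rewrite -size_extensions.
apply: (@leq_size_cover _ _ (fun u y => exists2 w, Jw (s ++ u) w & eball y r w)).
- exact: extensions_uniq.
- move=> u eu; have wsu := word_cat ws eu.
  have [w Ew suw] := limit_set_meets_piece wsu.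
  have [|y /= yC yw] := cov w; first by split=> //; exact: (sub_piece ws eu).
  by exists y => //; exists w.
move=> y W uW sW PW; rewrite -(size_map (cat s)).
apply: (KP (k + m)%N y).
- by rewrite map_inj_uniq// => u v /eqP; rewrite eqseq_cat// => /andP[_ /eqP].
- by move=> _ /mapP[u /sW eu ->]; exact: word_cat.
move=> _ /mapP[u uWu ->]; have [w suw yw] := PW u uWu.
have wsu := word_cat ws (sW _ uWu).
apply: le_trans (eudist_triangle w _ _) _; rewrite mulrDl lerD//.
  exact: le_trans rt.
exact: piece_dist wsu suw (piece_centre wsu).
Qed.

(** The ball meets boundedly many pieces of level [k]; balls about the centres of their descendants
    at level [k + m] form the cover. *)
Lemma cover_size_upper t : exists K : nat, forall k m x (rho r : R),
  (0 < k)%N -> rho <= t * delta k -> A * delta (k + m) <= r ->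
  exists2 C : seq (ept R n), eball x rho `&` E `<=` \bigcup_(y in [set` C]) eball y r
    & (size C <= K * N k (k + m))%N.
Proof.
have [K KP] := level_packing (t + A); exists K => k m x rho r k0 rt Ar.
pose meets s := `[< exists2 w, Jw s w & d x w <= rho >].
pose U := [seq s <- extensions ns 0 k | meets s].
have UP s : s \in U -> word ns k s.
  by rewrite mem_filter => /andP[_ /word_extensions0].
exists [seq z (s ++ u) | s <- U, u <- extensions ns k m]; last first.
  rewrite size_allpairs size_extensions leq_mul2r; apply/orP; right.
  apply: (KP k x) => //; first by rewrite filter_uniq// extensions_uniq.
  move=> s sU; have ws := UP _ sU; move: sU.
  rewrite mem_filter => /andP[/asboolP[w sw xw] _].
  apply: le_trans (eudist_triangle w _ _) _; rewrite mulrDl lerD//.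
    exact: le_trans rt.
  exact: piece_dist ws sw (piece_centre ws).
move=> w [xw /(_ (k + m)%N)/= []]; first by rewrite addn_gt0 k0.
move=> v wv; have [s [u [vE ws eu]]] := word_split wv => vw; rewrite {}vE in wv vw.
exists (z (s ++ u)) => /=; last first.
  by apply: le_trans Ar; exact: piece_dist wv (piece_centre wv) vw.
apply/allpairsP; exists (s, u); split=> //=; rewrite mem_filter.
apply/andP; split; last exact/word_extensions0.
by apply/asboolP; exists w => //; exact: (sub_piece ws eu).
Qed.

(** * The index [lidx] and the spectrum condition *)

Variable theta : R.
Hypothesis theta_itv : 0 < theta < 1.
Local Notation p := (theta^-1).
Local Notation l k := (lidx c theta k).

Lemma inv_theta_gt1 : 1 < p.
Proof. by case/andP: theta_itv => t0 t1; rewrite invf_gt1. Qed.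

(** [xget] returns a true maximum: [k] itself qualifies because [delta k <= 1] and [1 < p], and the
    qualifying indices are bounded because [delta] tends to zero. *)
Lemma lidxP k : (0 < k)%N ->
  [/\ (k <= l k)%N, delta k `^ p <= delta (l k) & delta (l k).+1 < delta k `^ p].
Proof.
move=> k0; have p1 := inv_theta_gt1; pose D := delta k `^ p.
have D0 : 0 < D by rewrite powR_gt0.
have Dk : D <= delta k.
  rewrite -[leRHS](powRr1 (ltW (delta_pos k))).
  by apply: ger_powR; rewrite ?delta_pos ?(delta_le1 c_itv) ?ltW.
pose Q m := (1 <= m)%N && (D <= delta m).
have Qk : Q k by rewrite /Q k0 Dk.
have [M MD] := delta_small (divr_gt0 D0 (ltr0Sn _ 1)).
have QM m : Q m -> (m <= M)%N.
  move=> /andP[_ Dm]; rewrite leqNgt; apply/negP => /ltnW /(delta_le c_itv).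
  by lra.
case: (ex_maxnP (ex_intro _ k Qk) QM) => i /andP[i1 Di] imax.
have [l1 Dl lmax] : [/\ (1 <= l k)%N, D <= delta (l k) &
    forall m, (1 <= m)%N -> D <= delta m -> (m <= l k)%N].
  apply: (xgetPex 0%N (P := [set l : nat | [/\ (1 <= l)%N, D <= delta l &
    forall m, (1 <= m)%N -> D <= delta m -> (m <= l)%N]])).
  by exists i; split=> // m m1 Dm; apply: imax; rewrite /Q m1.
split=> //; first exact: lmax.
rewrite ltNge; apply/negP => Dl1.
by have := lmax (l k).+1 isT Dl1; rewrite ltnn.
Qed.

(* [t <= ln N / ((1 - p) * ln delta)] amounts to [1 <= N * delta `^ ((p - 1) * t)]. *)
Lemma lower_spectrum_admissible t : 0 <= t ->
  (exists k1, forall k, (k1 < k)%N ->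
    1 <= (N k (l k))%:R * delta k `^ ((p - 1) * t)) ->
  exists b cc : R, [/\ 0 < b, 0 < cc & forall RR : R, 0 < RR -> RR < b ->
    forall x, E x -> ((cc * (RR / RR `^ p) `^ t)%:E
      <= covnum (RR `^ p) (eball x RR `&` E))%E].
Proof.
move=> t0 [k1 k1P]; have p1 := inv_theta_gt1.
have q0 : 0 <= (p - 1) * t by rewrite mulr_ge0// subr_ge0 ltW.
(* The level [k] chosen below satisfies [rho <= A / cmin * delta k]; raising this to the power [p]
   gives the constant. *)
have [K KP] := cover_size_lower ((A / cmin) `^ p).
(* This [b] forces [k1 < k], and [K.+1] keeps the denominator positive. *)
exists (A * delta k1), (A `^ ((p - 1) * t) / K.+1%:R); split.
- exact: mulr_gt0.
- by rewrite divr_gt0// powR_gt0.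
move=> rho rho0 rhob x Ex.
(* For the first level with [A * delta k <= rho], the piece containing [x] lies in the ball, and
   minimality together with [cmin] bounds [rho] above. *)
have [k kP kmin] : exists2 k, A * delta k <= rho &
    forall m, A * delta m <= rho -> (k <= m)%N.
  have [m mP] := delta_small (divr_gt0 rho0 A_gt0).
  have Qm : A * delta m <= rho by rewrite mulrC -ler_pdivlMr.
  case: (@ex_minnP (fun m => A * delta m <= rho)); first by exists m.
  by move=> k kP kmin; exists k.
have k1k : (k1 < k)%N.
  rewrite ltnNge; apply/negP => /(delta_le c_itv) kk; move: rhob; apply/negP.
  by rewrite -leNgt (le_trans _ kP)// ler_pM2l.
have k0 : (0 < k)%N by exact: leq_trans k1k.
have rho_up : rho <= A / cmin * delta k.
  case: k kmin k0 {kP k1k} => // k kmin _.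
  have : rho < A * delta k.
    by rewrite ltNge; apply/negP => /kmin; rewrite ltnn.
  move=> /ltW /le_trans; apply; rewrite -mulrA ler_pM2l// ler_pdivlMl// mulrC.
  by rewrite deltaS ler_pM2l// c_ge.
have [kl Dl _] := lidxP k0.
have [s ws sx] : exists2 s, word ns k s & Jw s x by exact: Ex.
apply: le_ereal_inf_tmp => _ [C cov <-]; rewrite lee_fin.
have := KP k (l k - k)%N s (rho `^ p) C; rewrite subnKC// => /(_ _ ws) KC.
have {KC} : (N k (l k) <= K * size C)%N.
  apply: KC.
    apply: le_trans (ler_wpM2l (powR_ge0 _ _) Dl).
    rewrite -powRM ?(ltW (delta_pos _))//; last by rewrite divr_ge0 ?ltW.
    apply: ge0_ler_powR => //; rewrite ?nnegrE ?(ltW rho0)//.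
      by rewrite (le_trans (ltW ltr01)) ?ltW.
    by rewrite mulr_ge0 ?divr_ge0 ?(ltW (delta_pos _))// ltW.
  apply: subset_trans cov => w [sw Ew]; split=> //; apply: le_trans kP.
  exact: piece_dist ws sx sw.
rewrite -(ler_nat R) natrM => NK.
rewrite powR_div_powR//; set q := (p - 1) * t in q0 *.
have rq : 0 < rho `^ q by exact: powR_gt0.
have dq : 0 < delta k `^ q by exact: powR_gt0.
have Aq : 0 < A `^ q by exact: powR_gt0.
rewrite ler_pdivrMr// ler_pdivrMr//.
have AR : A `^ q * delta k `^ q <= rho `^ q.
  rewrite -powRM ?(ltW (delta_pos _)) ?(ltW A_gt0)//.
  apply: ge0_ler_powR => //; rewrite nnegrE ?(ltW rho0)//.
  by rewrite mulr_ge0 ?(ltW (delta_pos _)) ?(ltW A_gt0).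
have CK : 1 <= (size C)%:R * K.+1%:R * delta k `^ q.
  apply: le_trans (k1P k k1k) _; rewrite ler_pM2r//; apply: le_trans NK _.
  by rewrite mulrC ler_wpM2l// ler_nat.
rewrite mulrAC; apply: le_trans (ler_wpM2l _ AR); last by rewrite mulr_ge0.
by rewrite mulrCA ler_pMr.
Qed.

(** The condition is tested at the radii [delta k], where [cover_size_upper] gives an efficient
    cover. The bounded factors lost are collected in [kappa]. *)
Lemma admissible_prod_ns_lower t :
  (exists b cc : R, [/\ 0 < b, 0 < cc & forall RR : R, 0 < RR -> RR < b ->
    forall x, E x -> ((cc * (RR / RR `^ p) `^ t)%:E
      <= covnum (RR `^ p) (eball x RR `&` E))%E]) ->
  exists2 kappa : R, 0 < kappa & exists k1, forall k, (k1 < k)%N ->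
    kappa <= (N k (l k))%:R * delta k `^ ((p - 1) * t).
Proof.
move=> [b [cc [b0 cc0 adm]]].
have [K KP] := cover_size_upper 1.
(* Pieces of level [l k] may be too large for the covering radius. One more generation passes the
   threshold for [delta], [m] further ones absorb the factor [A], and together they multiply the
   count by at most [K']. *)
have [m mP] : exists m, forall k, delta (k + m) <= A^-1 * delta k.
  by apply: delta_decay; rewrite invr_gt0.
have [K' K'P] : exists K', forall k, (N k (k + m.+1) <= K')%N.
  have [K' K'P] := descendants_bound (exprn_gt0 m.+1 cmin_gt0).
  by exists K' => k; apply: K'P; exact: delta_ratio_ge.
have [k1 k1b] := delta_small (divr_gt0 b0 (ltr0Sn _ 1)).
have [x Ex _] := limit_set_meets_piece (word_nil ns).
exists (cc / (K * K').+1%:R); first by rewrite divr_gt0.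
exists k1 => k k1k; have k0 : (0 < k)%N by exact: leq_trans k1k.
have [kl Dl Dl1] := lidxP k0.
have dkb : delta k < b by have := delta_le c_itv (ltnW k1k); lra.
have := KP k (l k - k + m.+1)%N x (delta k) (delta k `^ p) k0.
rewrite mul1r addnA subnKC// => /(_ (lexx _)) [|C cov].
  rewrite addnS -addSn -ler_pdivlMl//; apply: le_trans (mP _) _.
  by rewrite ler_pM2l ?invr_gt0// ltW.
rewrite (@prod_ns_cat k (l k)) ?leq_addr// => sC.
have {sC} : (size C <= (K * K').+1 * N k (l k))%N.
  apply: leq_trans sC _; rewrite mulnCA mulnC leq_mul2r; apply/orP; right.
  by rewrite (leq_trans _ (leqnSn _))// leq_mul2l K'P orbT.
rewrite -(ler_nat R) natrM => sC.
have := adm (delta k) (delta_pos k) dkb x Ex.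
move=> /le_trans /(_ (ereal_inf_lbound (ex_intro2 _ _ C cov erefl))).
rewrite lee_fin powR_div_powR// => /le_trans /(_ sC).
rewrite ler_pdivrMr ?powR_gt0// => ccN.
by rewrite ler_pdivrMr// mulrC mulrA.
Qed.

End RegularScheme.

(** * The lower spectrum *)

Section LimnEinf.
Variables (R : realType) (u : nat -> \bar R).

Lemma limn_einfE : limn_einf u = ereal_sup (range (einfs u)).
Proof. by rewrite limn_einf_lim; apply/cvg_lim => //; exact: cvg_einfs_sup. Qed.

Lemma limn_einf_ge (x : \bar R) k1 :
  (forall k, (k1 <= k)%N -> (x <= u k)%E) -> (x <= limn_einf u)%E.
Proof.
move=> xu; rewrite limn_einfE; apply: le_trans (ereal_sup_ubound _); last by exists k1.
by apply: le_ereal_inf_tmp => _ [k /= k1k <-]; exact: xu.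
Qed.

Lemma limn_einf_gt (x : \bar R) : (x < limn_einf u)%E ->
  exists k1, forall k, (k1 <= k)%N -> (x <= u k)%E.
Proof.
rewrite limn_einfE => /ereal_sup_gt[_ [k1 _ <-] xk1].
exists k1 => k k1k; apply: le_trans (ltW xk1) _.
by apply: ereal_inf_lbound; exists k.
Qed.

End LimnEinf.

(** Logarithms turn [kappa] into an additive constant, negligible against [ln y] as [y] tends to
    zero. *)
Lemma ler_mul_powR_ln (R : realType) (kappa x y p t : R) : 0 < kappa -> 0 < x -> 0 < y ->
  (kappa <= x * y `^ ((p - 1) * t)) = (ln kappa + t * ((1 - p) * ln y) <= ln x).
Proof.
move=> k0 x0 y0; have yq : 0 < y `^ ((p - 1) * t) by exact: powR_gt0.
rewrite -ler_ln ?posrE ?mulr_gt0// lnM ?posrE// ln_powR -lerBrDr.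
by congr (_ <= _); ring.
Qed.

Unset Implicit Arguments.

Theorem theorem4 (R : realType) (n : nat) (J : set (ept R n))
    (c : nat -> R) (ns : nat -> nat) (a : nat -> R) (E : set (ept R n))
    (theta : R) :
  (0 < n)%N ->
  (forall k, (1 <= k)%N -> 0 < a k) ->
  cvg ((fun N => \sum_(1 <= k < N) a k) @ \oo) ->
  (forall k, (1 <= k)%N -> (2 <= ns k)%N) ->
  (forall k, (1 <= k)%N -> 0 < c k < 1) ->
  0 < inf [set c k | k in [set k : nat | (1 <= k)%N]] ->
  eclosed J -> ebounded J -> (exists x, einterior J x) ->
  in_cantor_class J c ns a E ->
  0 < theta < 1 ->
  lower_spectrum theta E =
  limn_einf (fun k : nat =>
    ((ln ((\prod_(k.+2 <= i < (lidx c theta k.+1).+1) ns i)%N%:R : R))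
      / ((1 - theta^-1) * ln (delta c k.+1)))%:E).
Proof.
move=> n0 a0 acvg ns2 c01 cinf clJ bJ iJ [Jw [JwN Jwstep Jwdisj EE]] th01.
have [A [e [z [A0 e0 Adist zJ zsep]]]] :=
  scheme_regular n0 a0 acvg c01 bJ iJ JwN Jwstep Jwdisj.
have Jsub := piece_sub Jwstep.
have Jcl := piece_closed clJ JwN Jwstep.
set cmin := inf _ in cinf.
have cge k : (1 <= k)%N -> cmin <= c k.
  move=> k1; apply: ge_inf; last by exists k.
  by exists 0 => _ [i /= i1 <-]; have /andP[/ltW] := c01 i i1.
have p1 := inv_theta_gt1 th01.
(* Both factors are negative, so clearing this denominator preserves inequalities. At level [0] it
   would vanish, since [delta c 0 = 1]. *)
have D_gt0 k : (0 < k)%N -> 0 < (1 - theta^-1) * ln (delta c k).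
  move=> k0; rewrite nmulr_rgt0 ?subr_lt0//.
  by rewrite ln_lt0// delta_gt0//= delta_lt1.
have N_gt0 k l : 0 < (\prod_(k.+1 <= i < l.+1) ns i)%N%:R :> R.
  by rewrite ltr0n prod_ns_gt0.
have d_gt0 := delta_gt0 c01.
have adm0 t : 0 <= t ->
    (exists k1, forall k, (k1 <= k)%N ->
       t <= ln (\prod_(k.+2 <= i < (lidx c theta k.+1).+1) ns i)%N%:R
         / ((1 - theta^-1) * ln (delta c k.+1))) ->
    (t%:E <= lower_spectrum theta E)%E.
  move=> t0 [k1 k1P]; apply: ereal_sup_ubound; exists t => //; split=> //.
  rewrite EE.
  apply: (lower_spectrum_admissible ns2 c01 cinf cge A0 e0 Adist zJ zsep Jsub Jcl th01 t0).
  exists k1 => -[//|k] k1k; rewrite ler_mul_powR_ln// ln1 add0r -ler_pdivlMr ?D_gt0//.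
  exact: k1P.
apply/eqP; rewrite eq_le; apply/andP; split.
  apply: ge_ereal_sup => _ [t [t0 + <-]]; rewrite EE.
  move=> /(admissible_prod_ns_lower ns2 c01 cinf cge A0 e0 Adist zJ zsep Jsub Jcl th01).
  move=> [kappa kappa0 [k1 k1P]]; apply/lee_subgt0Pr => eps eps0.
  rewrite -EFinB.
  have ep0 : 0 < eps * (theta^-1 - 1) by rewrite mulr_gt0// subr_gt0.
  (* From level [m] on, [ln kappa] is at least [- eps] times the denominator, so it changes the
     lower bound on the quotient by at most [eps]. *)
  have [m mP] := delta_small ns2 c01 A0 e0 Adist zJ zsep Jsub
    (expR_gt0 (ln kappa / (eps * (theta^-1 - 1)))).
  apply: (@limn_einf_ge _ _ _ (maxn k1 m)) => k; rewrite geq_max => /andP[k1k mk].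
  have := k1P k.+1 k1k; rewrite ler_mul_powR_ln// lee_fin ler_pdivlMr ?D_gt0//.
  have : delta c k.+1 <= expR (ln kappa / (eps * (theta^-1 - 1))).
    exact: le_trans (delta_le c01 (leqW mk)) mP.
  rewrite -[X in X <= _]lnK ?posrE// ler_expR ler_pdivlMr// => dk; lra.
(* The exponent [0] is admissible because the products are at least [1]; this excludes [-oo] and
   makes the intermediate [t] below nonnegative. *)
have dim_ge0 : (0 <= lower_spectrum theta E)%E.
  apply: adm0 => //; exists 0%N => k _; rewrite divr_ge0 ?(ltW (D_gt0 _ _))//.
  by rewrite ln_ge0// ler1n prod_ns_gt0.
set L := limn_einf _; rewrite leNgt; apply/negP => dimL.
(* A real number strictly between the two values would be admissible by [adm0] and yet exceed the
   supremum. *)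
suff [t t0 /andP[dimt /limn_einf_gt[k1 k1P]]] :
    exists2 t : R, 0 <= t & (lower_spectrum theta E < t%:E < L)%E.
  suff : (t%:E <= lower_spectrum theta E)%E by rewrite leNgt dimt.
  by apply: adm0 => //; exists k1 => k k1k; rewrite -lee_fin; exact: k1P.
case: (lower_spectrum theta E) dim_ge0 dimL => [x| |//]; last first.
  by move=> _; rewrite ltNge leey.
rewrite lee_fin => x0.
case: L => [y|_|//].
  rewrite lte_fin => xy; exists ((x + y) / 2); first by lra.
  by rewrite !lte_fin; apply/andP; split; lra.
by exists (x + 1); rewrite ?lte_fin ?ltry; lra.
Qed.
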